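(* For every semiring $S$, the semisubtractive space $\mathcal{I}_s(S)$ is connected.
   Context: A semiring $S$ means a commutative semiring with multiplicative identity $1$, with $0\neq 1$. An ideal of $S$ is an additive submonoid $\mathfrak{a}$ of $S$ with $sx\in\mathfrak{a}$ for all $s\in S$, $x\in\mathfrak{a}$. $\mathcal{V}(S)$ denotes the set of elements $x\in S$ having an additive inverse $-x$ in $S$. An ideal $\mathfrak{a}$ is semisubtractive if $x\in\mathfrak{a}\cap\mathcal{V}(S)$ implies $-x\in\mathfrak{a}\cap\mathcal{V}(S)$; $\mathcal{I}_s(S)$ is the set of semisubtractive ideals of $S$. The semisubtractive space $\mathcal{I}_s(S)$ is this set with the topology having as subbasic closed sets the sets $\mathcal{H}(\mathfrak{a}):=\{\mathfrak{b}\in\mathcal{I}_s(S)\mid\mathfrak{b}\supseteq\mathfrak{a}\}$, $\mathfrak{a}\in\mathcal{I}_s(S)$. *)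

(* Defs.v *)
From HB Require Import structures.
From mathcomp Require Import all_boot all_algebra.
From mathcomp Require Import boolp classical_sets functions topology.

Set Implicit Arguments.
Unset Strict Implicit.
Unset Printing Implicit Defensive.

Import GRing.Theory.

Local Open Scope classical_set_scope.
Local Open Scope ring_scope.

(* Improper ideals are allowed; the library's [idealr_closed] is restricted to
   proper ideals of rings. *)
Definition is_ideal (S : comNzSemiRingType) (a : set S) : Prop :=
  [/\ a 0,
      forall x y, a x -> a y -> a (x + y) &
      forall s x, a x -> a (s * x)].

Definition add_invertible (S : comNzSemiRingType) : set S :=
  [set x | exists y, x + y = 0].

(* The opposite of [x] is denoted by any [y] with [x + y = 0], since a semiring
   has no opposite operation; such a [y] is unique. *)
Definition is_semisubtractive (S : comNzSemiRingType) (a : set S) : Prop :=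
  forall x y, (a `&` @add_invertible S) x -> x + y = 0 ->
    (a `&` @add_invertible S) y.

Record semisub_space (S : comNzSemiRingType) : Type := SemisubIdeal {
  semisub_set :> set S;
  semisub_ideal : is_ideal semisub_set;
  semisub_semisubtractive : is_semisubtractive semisub_set
}.

Definition hull (S : comNzSemiRingType) (a : semisub_space S) :
    set (semisub_space S) :=
  [set b : semisub_space S | (a : set S) `<=` (b : set S)].

(* The closed subbase of all [hull a], given by its complements since the
   library generates topologies from open subbases. *)
Definition hull_subbase (S : comNzSemiRingType) : set (set (semisub_space S)) :=
  [set ~` hull a | a in [set: semisub_space S]].

HB.instance Definition _ (S : comNzSemiRingType) :=
  gen_eqMixin (semisub_space S).
HB.instance Definition _ (S : comNzSemiRingType) :=
  gen_choiceMixin (semisub_space S).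
HB.instance Definition _ (S : comNzSemiRingType) :=
  isSubBaseTopological.Build (semisub_space S) (@hull_subbase S) id.

(* Main.v *)
Require Import Defs.
From HB Require Import structures.
From mathcomp Require Import all_boot all_algebra.
From mathcomp Require Import boolp classical_sets functions topology.

(** The whole semiring is itself a semisubtractive ideal, and it contains every
    ideal, so it belongs to every subbasic closed set.  Hence it lies in no
    subbasic open set, and the only open set around it is the whole space.  Of
    two complementary open sets one contains this point, so it is everything
    and the other is empty. *)

Local Open Scope classical_set_scope.

Lemma setT_ideal (S : comNzSemiRingType) : is_ideal [set: S].
Proof. by split. Qed.

Lemma setT_semisubtractive (S : comNzSemiRingType) :
  is_semisubtractive [set: S].
Proof. by move=> x y _ xy0; split=> //; exists x; rewrite GRing.addrC. Qed.

Definition whole_ideal (S : comNzSemiRingType) : semisub_space S :=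
  SemisubIdeal (setT_ideal S) (setT_semisubtractive S).

(** Among the finite intersections of subbasic open sets, only the empty one,
    which is the whole space, can contain a point avoiding the subbase. *)
Lemma open_whole_ideal (S : comNzSemiRingType) (U : set (semisub_space S)) :
  open U -> U (whole_ideal S) -> U = [set: semisub_space S].
Proof.
case=> D sD <- [V DV Vtop]; rewrite -subTset => b _; exists V => //.
have [F sF FV] := sD _ DV; rewrite -FV in Vtop.
change (V b); rewrite -FV => W WF.
have [a _ aW] := set_mem (sF _ WF).
by have := Vtop _ WF; rewrite -aW; case.
Qed.

Theorem proposition2p26 (S : comNzSemiRingType) :
  connected [set: semisub_space S].
Proof.
move=> B [b Bb] [U oU]; rewrite setTI => BU [C cC]; rewrite setTI => BC.
have [Btop|nBtop] := pselect (B (whole_ideal S)).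
  by apply: open_whole_ideal => //; rewrite BU.
have oB : open (~` B) by rewrite BC openC.
by have : (~` B) b by rewrite (open_whole_ideal _ _ oB nBtop).
Qed.
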